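(* Let $S$ and $T$ be totally ordered sets and let $P=S\times T$ with the product order. Every pointwise finite-dimensional middle exact persistence module $M\colon P\to\mathbf{Vec}$ is isomorphic to a direct sum of block modules $k_B$, $B\subseteq P$ a block.
   Context: Persistence modules over a poset are functors to $k$-vector spaces (poset viewed as a category with one morphism $p\to q$ iff $p\le q$), with structure maps $M(p\le q)$; pointwise finite-dimensional means each $M_p$ is finite-dimensional. $P=S\times T$ has $(x,y)\le(x',y')$ iff $x\le x'$ and $y\le y'$. $M$ is middle exact if for all $x\le x'$ in $S$ and $y\le y'$ in $T$, with $a=(x,y)$, $b=(x,y')$, $c=(x',y)$, $d=(x',y')$, the sequence $M_a\xrightarrow{(M(a\le b),\,M(a\le c))} M_b\oplus M_c\xrightarrow{M(b\le d)-M(c\le d)} M_d$ is exact at $M_b\oplus M_c$. An interval ideal of a totally ordered set is a non-empty subset closed downwards; an interval filter is a non-empty subset closed upwards; an interval is a non-empty convex subset. A non-empty subset $B\subseteq P$ is a block if it is of one of the forms: (db) $J_S\times J_T$ with $J_S,J_T$ interval ideals; (bb) $J_S\times J_T$ with $J_S,J_T$ interval filters; (vb) $J_S\times T$ with $J_S$ an interval; (hb) $S\times J_T$ with $J_T$ an interval. For a subset $B$, $k_B$ denotes the module with $(k_B)_p=k$ for $p\in B$, $0$ otherwise, and $k_B(p\le q)=\mathrm{id}_k$ if $p,q\in B$, zero otherwise. *)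

(* Defs.v *)
From HB Require Import structures.
From mathcomp Require Import all_boot all_order all_algebra.
From Stdlib Require Import List.
Set Implicit Arguments. Unset Strict Implicit. Unset Printing Implicit Defensive.
Import Order.TTheory GRing.Theory.
Local Open Scope ring_scope.

Section Defs.
Variables (K : fieldType) (dS dT : Order.disp_t)
          (S : orderType dS) (T : orderType dT).

Definition ple (p q : S * T) : Prop := (p.1 <= q.1)%O /\ (p.2 <= q.2)%O.

(* A pointwise finite-dimensional persistence module over P: a finite-
   dimensional K-vector space V p at each point and linear structure maps
   f p q (only relevant for p <= q), satisfying functoriality. *)
Definition is_pmodule (V : S * T -> vectType K)
  (f : forall p q : S * T, 'Hom(V p, V q)) : Prop :=
  (forall p, f p p = \1%VF) /\
  (forall p q r, ple p q -> ple q r -> f p r = (f q r \o f p q)%VF).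

(* Middle exactness: M_a -> M_b (+) M_c -> M_d exact at M_b (+) M_c,
   i.e. kernel of (u,w) |-> f b d u - f c d w equals image of
   v |-> (f a b v, f a c v). *)
Definition middle_exact (V : S * T -> vectType K)
  (f : forall p q : S * T, 'Hom(V p, V q)) : Prop :=
  forall (x x' : S) (y y' : T), (x <= x')%O -> (y <= y')%O ->
  let a := (x, y) in let b := (x, y') in let c := (x', y) in let d := (x', y') in
  forall (u : V b) (w : V c),
    (f b d u - f c d w = 0) <-> (exists v : V a, f a b v = u /\ f a c v = w).

Definition interval_ideal {d} {X : orderType d} (J : X -> Prop) : Prop :=
  (exists x, J x) /\ (forall x y : X, (y <= x)%O -> J x -> J y).
Definition interval_filter {d} {X : orderType d} (J : X -> Prop) : Prop :=
  (exists x, J x) /\ (forall x y : X, (x <= y)%O -> J x -> J y).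
Definition interval {d} {X : orderType d} (J : X -> Prop) : Prop :=
  (exists x, J x) /\
  (forall x y z : X, (x <= y)%O -> (y <= z)%O -> J x -> J z -> J y).

Definition is_block (B : S * T -> Prop) : Prop :=
  (exists (JS : S -> Prop) (JT : T -> Prop),
      interval_ideal JS /\ interval_ideal JT /\ forall p, B p <-> JS p.1 /\ JT p.2)
  \/ (exists (JS : S -> Prop) (JT : T -> Prop),
      interval_filter JS /\ interval_filter JT /\ forall p, B p <-> JS p.1 /\ JT p.2)
  \/ (exists JS : S -> Prop, interval JS /\ forall p, B p <-> JS p.1)
  \/ (exists JT : T -> Prop, interval JT /\ forall p, B p <-> JT p.2).

(* The direct sum (+)_{i in I} k_{B i}: at p it is the space of finitely
   supported functions g : I -> K with g i = 0 whenever p \notin B i;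
   the structure map p <= q acts on the i-th component by the identity if
   p, q \in B i and by 0 otherwise. *)
Definition in_block_sum (I : Type) (B : I -> S * T -> Prop) (p : S * T)
  (g : I -> K) : Prop :=
  (exists s : list I, forall i, g i <> 0 -> In i s) /\
  (forall i, g i <> 0 -> B i p).

Definition block_sum_map (I : Type) (B : I -> S * T -> Prop) (p q : S * T)
  (g h : I -> K) : Prop :=
  forall i, (B i p /\ B i q -> h i = g i) /\ (~ (B i p /\ B i q) -> h i = 0).

Definition iso_to_block_sum (V : S * T -> vectType K)
  (f : forall p q : S * T, 'Hom(V p, V q))
  (I : Type) (B : I -> S * T -> Prop) (phi : forall p, V p -> I -> K) : Prop :=
  (forall p (a : K) (u v : V p) i,
      phi p (a *: u + v) i = a * phi p u i + phi p v i) /\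
  (forall p (u : V p), in_block_sum B p (phi p u)) /\
  (forall p (u v : V p), (forall i, phi p u i = phi p v i) -> u = v) /\
  (forall p (g : I -> K), in_block_sum B p g ->
      exists u : V p, forall i, phi p u i = g i) /\
  (forall p q (u : V p), ple p q -> block_sum_map B p q (phi p u) (phi q (f p q u))).

End Defs.

(* Main.v *)
Require Import Defs.
From HB Require Import structures.
From mathcomp Require Import all_boot all_order all_algebra.
From mathcomp Require Import boolp classical_sets.
From Stdlib Require Import List.

(** A nonzero middle exact module M has a block summand k_B containing any
    given point p0 with M_{p0} <> 0. A vector v of M_{p0} generates such a
    summand as soon as it lifts to every lower point of B by a vector that dies
    outside B, and its image at every higher point of B is not in the span of
    the images coming from outside B: by finite dimensionality the lifts, and
    dually the functionals detecting v, can be chosen compatibly. Middle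
    exactness transports kernels and images between rows and columns, so the
    four chains of subspaces of M_{p0} (kernels to the right and upwards, images
    from the left and from below) suffice to find B and v.

    For the global decomposition take a maximal set E of commuting idempotent
    endomorphisms of M. Pointwise M is the direct sum of the joint eigenspaces
    of E. Each joint eigenspace is a middle exact submodule, and the projection
    onto a block summand of it commutes with E, hence belongs to E and acts on
    that eigenspace as the identity; so the eigenspace is a block module. *)

Set Implicit Arguments. Unset Strict Implicit. Unset Printing Implicit Defensive.
Import Order.TTheory GRing.Theory.
Local Open Scope ring_scope.

(** * Extremal choices and finite-dimensional linear algebra *)

Lemma exists_minimizer (D : Type) (P : D -> Prop) (m : D -> nat) :
  (exists d, P d) -> exists d, P d /\ forall d', P d' -> (m d <= m d')%N.
Proof.
move=> [d Pd]; have [n] := ubnP (m d); elim: n d Pd => // n IH d Pd ltn.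
have [[d' [Pd' lt]]|min_d] := pselect (exists d', P d' /\ (m d' < m d)%N).
  by apply: IH Pd' _; apply: leq_trans lt _.
exists d; split=> // d' Pd'; rewrite leqNgt; apply/negP => lt.
by apply: min_d; exists d'.
Qed.

Lemma exists_maximizer (D : Type) (P : D -> Prop) (m : D -> nat) (b : nat) :
  (forall d, (m d <= b)%N) ->
  (exists d, P d) -> exists d, P d /\ forall d', P d' -> (m d' <= m d)%N.
Proof.
move=> mb /(exists_minimizer (fun d => b - m d)%N) [d [Pd min_d]].
by exists d; split=> // d' /min_d; rewrite leq_sub2lE.
Qed.

Section LinearAlgebra.
Variable K : fieldType.

(** A subspace of largest dimension inside [X] exhausts it: joining the line of a further [w] in [X]
    stays inside [X]. *)
Lemma vspace_of_pred (W : vectType K) (X : W -> Prop) :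
  X 0 -> (forall a u v, X u -> X v -> X (a *: u + v)) ->
  exists U : {vspace W}, forall w, w \in U <-> X w.
Proof.
move=> X0 XZD.
have [|U [UX maxU]] := @exists_maximizer {vspace W}
    (fun U => forall w, w \in U -> X w) (fun U => \dim U) (\dim {:W})
    (fun U => dimvS (subvf U)).
  by exists 0%VS => w; rewrite memv0 => /eqP ->.
exists U => w; split=> [/UX//|Xw].
have UwX z : z \in (U + <[w]>)%VS -> X z.
  case/memv_addP => u uU [_ /vlineP[a ->] ->].
  by rewrite addrC; apply: XZD => //; apply: UX.
have /eqP -> : U == (U + <[w]>)%VS by rewrite eqEdim addvSl maxU.
exact: (subvP (addvSr U <[w]>) _ (memv_line w)).
Qed.

Lemma linear_lfun (U W : vectType K) (h : U -> W) :
  (forall a u v, h (a *: u + v) = a *: h u + h v) ->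
  exists F : 'Hom(U, W), forall u, F u = h u.
Proof.
move=> h_lin.
pose hL : {linear U -> W} := HB.pack h (GRing.isLinear.Build K U W *:%R h h_lin).
by exists (linfun hL) => u; rewrite lfunE.
Qed.

(** Since [r] vanishes on the preimage of [Z], it factors through the image of [h] in the quotient
    of [W] by [Z]. The quotient is realised inside [W] by the projector [pr] with kernel [Z]. *)
Lemma functional_extension (U W R : vectType K) (h : 'Hom(U, W))
  (Z : {vspace W}) (r : 'Hom(U, R)) :
  (forall u, h u \in Z -> r u = 0) ->
  exists rho : 'Hom(W, R),
    (forall u, rho (h u) = r u) /\ forall z, z \in Z -> rho z = 0.
Proof.
move=> hr; pose pr := (\1 - projv Z)%VF : 'End(W).
have prE w : pr w = w - projv Z w by rewrite !lfunE /= opp_lfunE id_lfunE.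
have prZ w : w \in Z -> pr w = 0 by move=> ?; rewrite prE projv_id ?subrr.
have prN w : pr w = 0 -> w \in Z.
  by rewrite prE => /eqP; rewrite subr_eq0 => /eqP ->; rewrite memv_proj.
exists (r \o (pr \o h)^-1 \o pr)%VF; split=> [u|z zZ]; last first.
  by rewrite comp_lfunE prZ // linear0.
rewrite !comp_lfunE /=; apply/eqP; rewrite -subr_eq0 -linearB; apply/eqP/hr.
apply: prN; rewrite -comp_lfunE linearB /=.
rewrite limg_lfunVK; first by rewrite comp_lfunE subrr.
by rewrite -comp_lfunE memv_img ?memvf.
Qed.

Lemma separating_functional (W : vectType K) (Z : {vspace W}) (v : W) :
  v \notin Z ->
  exists rho : 'Hom(W, K^o), rho v = 1 /\ forall z, z \in Z -> rho z = 0.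
Proof.
move=> vZ; have [|h hE] := @linear_lfun K^o W (fun a => a *: v).
  by move=> a b c; rewrite scalerDl scalerA.
have [a|rho [rhoh rhoZ]] := @functional_extension _ _ _ h Z (\1%VF : 'End(K^o)).
  rewrite hE id_lfunE => avZ; apply/eqP; apply: contraNT vZ => a0.
  by rewrite -[v](scalerK a0) memvZ.
by exists rho; split=> //; rewrite -[v]scale1r -hE rhoh id_lfunE.
Qed.

Definition affine (W : lmodType K) (Y : W -> Prop) :=
  forall a b c l, Y a -> Y b -> Y c -> Y (l *: (b - c) + a).

(** Minimise the dimension of the space of differences. A member of the family inside the minimiser
    has the same differences, hence equals it; by directedness the minimiser lies in every
    member. *)
Lemma affine_directed_min (W : vectType K) (Fm : (W -> Prop) -> Prop) :
  (exists Y, Fm Y) ->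
  (forall Y, Fm Y -> affine Y /\ exists w, Y w) ->
  (forall Y Y', Fm Y -> Fm Y' ->
     exists2 Z, Fm Z & (forall w, Z w -> Y w) /\ (forall w, Z w -> Y' w)) ->
  exists Y, Fm Y /\ forall Y', Fm Y' -> forall w, Y w -> Y' w.
Proof.
move=> [Y0 FY0] affF dirF.
pose D (Y : W -> Prop) (U : {vspace W}) :=
  forall w, w \in U <-> exists b c, [/\ Y b, Y c & w = b - c].
have exD Y : Fm Y -> exists U, D Y U.
  move=> /affF[aY [w0 Yw0]]; apply: vspace_of_pred.
    by exists w0, w0; rewrite subrr.
  move=> a u v [b [c [Yb Yc ->]]] [b' [c' [Yb' Yc' ->]]].
  by exists (a *: (b - c) + b'), c'; split; [exact: aY | | rewrite addrA].
have [|[Y U] /= [[FY DU] minY]] := @exists_minimizer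
    ((W -> Prop) * {vspace W})%type (fun YU => Fm YU.1 /\ D YU.1 YU.2)
    (fun YU => \dim YU.2).
  by have [U DU] := exD _ FY0; exists (Y0, U).
exists Y; split=> // Y' FY' w Yw.
have [Z FZ [ZY ZY']] := dirF _ _ FY FY'.
have [U' DU'] := exD _ FZ; have [aZ [z Zz]] := affF _ FZ.
have sU : (U' <= U)%VS.
  apply/subvP => u /DU'[b [c [Zb Zc ->]]]; apply/DU.
  by exists b, c; split=> //; apply: ZY.
have /eqP UU : U' == U by rewrite eqEdim sU; apply: (minY (Z, U')).
have /DU : exists b c, [/\ Y b, Y c & w - z = b - c].
  by exists w, z; split=> //; apply: ZY.
rewrite -UU => /DU'[b [c [Zb Zc e]]]; apply: ZY'.
by rewrite -[w](subrK z) e -[b - c]scale1r; apply: aZ.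
Qed.

End LinearAlgebra.

(** * Inverse limits of affine subspaces *)

Section InverseLimit.
Variables (K : fieldType) (D : Type) (dom : D -> Prop) (le : D -> D -> Prop).
Variables (W : D -> vectType K) (g : forall i j, W j -> W i).
Variable A : forall i, W i -> Prop.
Arguments g : clear implicits.
Arguments A : clear implicits.

Hypothesis g_linear : forall i j a u v, g i j (a *: u + v) = a *: g i j u + g i j v.
Hypothesis le_tr : forall i j k, le i j -> le j k -> le i k.
Hypothesis g_comp : forall i j k w, le i j -> le j k -> g i j (g j k w) = g i k w.
Hypothesis directed : forall i j, dom i -> dom j ->
  exists k, [/\ dom k, le i k & le j k].
Hypothesis A_affine : forall i, dom i -> affine (A i).
Hypothesis A_stable : forall i j w, dom i -> dom j -> le i j -> A j w -> A i (g i j w).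
Hypothesis A_nonempty : forall i, dom i -> exists w, A i w.

Let pt := {i : D & W i}.
Let below k (s : list pt) := forall x, In x s -> le (projT1 x) k.
Let realizes k (u : W k) (s : list pt) :=
  forall x, In x s -> g (projT1 x) k u = projT2 x.

(** Prescribed values are tested finitely many at a time, so unions of chains stay consistent and
    Zorn's lemma applies. *)
Let consistent (G : set pt) :=
  (forall x, G x -> dom (projT1 x)) /\
  forall s, (forall x, In x s -> G x) -> forall k, dom k -> below k s ->
    exists u, A k u /\ realizes u s.

Let gB i j u v : g i j (u - v) = g i j u - g i j v.
Proof. by rewrite addrC -scaleN1r g_linear scaleN1r addrC. Qed.

Let consistent_maximal :
  exists G, consistent G /\ forall G', (G `<` G')%classic -> ~ consistent G'.
Proof.
apply: Zorn_bigcup => F Fc Ftot; split.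
  by move=> x [G FG Gx]; have [h _] := Fc _ FG; apply: h.
move=> s sF k dk ks.
(* A finite list in the union of a chain lies in one member; the empty list stands apart because the
   chain may be empty. *)
have [->|[G FG sG]] : s = nil \/ exists2 G, F G & forall x, In x s -> G x.
  elim: s sF {ks} => [|x s IH] sF; first by left.
  right; have [Gx FGx xG] := sF x (or_introl erefl).
  have [|->|[G FG sG]] := IH; first by move=> y ys; apply: sF; right.
    by exists Gx => // y [<-|[]].
  have [sub|sub] := Ftot _ _ FG FGx.
    by exists Gx => // y [<-//|/sG/sub].
  by exists G => // y [<-|/sG//]; apply: sub.
- by have [u Au] := A_nonempty dk; exists u; split.
- by have [_ h] := Fc _ FG; apply: h.
Qed.

Let consistent_extend G i : consistent G -> dom i ->
  exists w : W i, consistent (fun x => G x \/ x = existT _ i w).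
Proof.
move=> [Gd Gc] di.
pose Y s k := fun w : W i => exists u, [/\ A k u, realizes u s & w = g i k u].
pose ok s k := [/\ dom k, le i k, below k s & forall x, In x s -> G x].
have [|||Y0 [[s [k [oks ->]]] minY]] := @affine_directed_min K (W i)
    (fun Z => exists s k, ok s k /\ Z = Y s k).
- have [k [dk ik _]] := directed di di.
  by exists (Y nil k), nil, k; split=> //; split=> // x [].
- move=> _ [s [k [[dk ik ks sG] ->]]]; split; last first.
    by have [u [Au ru]] := Gc s sG k dk ks; exists (g i k u), u.
  move=> _ _ _ l [a [Aa ra ->]] [b [Ab rb ->]] [c [Ac rc ->]].
  exists (l *: (b - c) + a); split; first exact: A_affine.
    by move=> x xs; rewrite g_linear gB ra // rb // rc // subrr scaler0 add0r.
  by rewrite g_linear gB.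
- move=> _ _ [s [k [[dk ik ks sG] ->]]] [s' [k' [[dk' ik' ks' sG'] ->]]].
  have [m [dm km km']] := directed dk dk'.
  have stab s1 k1 s2 : dom k1 -> le i k1 -> le k1 m -> below k1 s1 ->
      (forall x, In x s1 -> In x s2) -> forall w, Y s2 m w -> Y s1 k1 w.
    move=> d1 i1 k1m b1 s12 _ [u [Au ru ->]]; exists (g k1 m u); split.
    - exact: A_stable.
    - by move=> x x1; rewrite g_comp //; [apply/ru/s12 | apply: b1].
    - by rewrite g_comp.
  exists (Y (s ++ s') m).
    exists (s ++ s'), m; split=> //; split=> //; first exact: le_tr ik km.
      by move=> x /in_app_iff[/ks|/ks'] h; [apply: le_tr h km|apply: le_tr h km'].
    by move=> x /in_app_iff[/sG|/sG'].
  by split; apply: stab => // x xs; apply/in_app_iff; [left|right].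
have [dk ik ks sG] := oks.
have [u0 [Au0 ru0]] := Gc s sG k dk ks.
exists (g i k u0); set x0 := existT _ i _.
have minw s' k' : ok s' k' -> Y s' k' (g i k u0).
  by move=> oks'; apply: (minY (Y s' k')); [exists s', k' | exists u0].
split=> [x [/Gd//|->//]|s1 s1G k1 dk1 ks1].
have [s2 [s2G s2s1 s12]] : exists s2, [/\ forall x, In x s2 -> G x,
    forall x, In x s2 -> In x s1 & forall x, In x s1 -> In x s2 \/ x = x0].
  elim: s1 s1G {ks1} => [|x s1 IH] s1G; first by exists nil; split=> // x [].
  have [y ys1|s2 [s2G s2s1 s12]] := IH; first by apply: s1G; right.
  have [Gx|xx0] := s1G x (or_introl erefl).
    exists (x :: s2); split=> [y [<-//|/s2G//]|y [->|/s2s1]|y [->|/s12[]]] //=;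
      by [left|right|left; left|left; right|right].
  exists s2; split=> // y; first by move/s2s1; right.
  by case=> [<-|/s12//]; right.
have ks2 : below k1 s2 by move=> x /s2s1/ks1.
(* If the new prescription occurs, [k1] lies above [i] and minimality supplies [u]; otherwise [k1]
   need not lie above [i], and the consistency of [G] suffices. *)
have [x0s1|x0s1] := pselect (In x0 s1).
  have [|u [Au ru gu]] := minw s2 k1; first by split=> //; exact: ks1 x0s1.
  by exists u; split=> // x /s12[/ru//|->].
have [u [Au ru]] := Gc s2 s2G k1 dk1 ks2.
exists u; split=> // x xs1; have [/ru//|ex] := s12 x xs1.
by case: x0s1; rewrite -ex.
Qed.

(* A maximal consistent set of prescribed values is the graph of a
   compatible family: at a further index the values compatible with finitely
   many prescriptions form a directed family of affine sets, which has a
   least element by finite dimensionality. *)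
Lemma affine_inverse_limit_nonempty :
  exists w : forall i, W i, (forall i, dom i -> A i (w i)) /\
    forall i j, dom i -> dom j -> le i j -> g i j (w j) = w i.
Proof.
have [G [Gc maxG]] := consistent_maximal.
have exG i : exists w : W i, dom i -> G (existT _ i w).
  have [di|] := pselect (dom i); last by exists 0.
  have [w cw] := consistent_extend Gc di; exists w => _.
  apply: contrapT => nG; apply: (maxG _ _ cw); split; first by move=> x; left.
  by move=> /(_ (existT _ i w)) h; apply/nG/h; right.
pose w i := projT1 (cid (exG i)); exists w.
have Gw i : dom i -> G (existT _ i (w i)) by rewrite /w; case: cid.
have real i j : dom i -> dom j -> exists k u, [/\ dom k, le i k, le j k, A k u
    & g i k u = w i /\ g j k u = w j].
  move=> di dj; have [k [dk ik jk]] := directed di dj.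
  have [||u [Au ru]] := (Gc.2 [:: existT _ i (w i); existT _ j (w j)] _ k dk).
  - by move=> x [<-|[<-|[]]]; apply: Gw.
  - by move=> x [<-|[<-|[]]].
  exists k, u; split=> //; split.
    exact: (ru (existT _ i (w i)) (or_introl erefl)).
  exact: (ru (existT _ j (w j)) (or_intror (or_introl erefl))).
split=> [i di|i j di dj ij].
  by have [k [u [dk ik _ Au [<- _]]]] := real i i di di; apply: A_stable.
have [k [u [dk ik jk Au [<- <-]]]] := real i j di dj.
exact: g_comp.
Qed.

End InverseLimit.

(** * Splitting off a block module over a rectangle *)

Section BlockSummand.
Variables (K : fieldType) (dS dT : Order.disp_t)
          (S : orderType dS) (T : orderType dT).
Variables (V : S * T -> vectType K) (f : forall p q : S * T, 'Hom(V p, V q)).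

(* The pair of maps k_B -> M -> k_B with composite the identity, given by the
   images b of the generators and by the functionals r. *)
Definition is_block_summand (B : S * T -> Prop)
  (b : forall p, V p) (r : forall p, 'Hom(V p, K^o)) : Prop :=
  [/\ forall p, B p -> r p (b p) = 1,
      forall p, ~ B p -> b p = 0 /\ forall u, r p u = 0,
      forall p q, ple p q -> B p -> B q ->
        f p q (b p) = b q /\ forall u, r q (f p q u) = r p u,
      forall p q, ple p q -> B p -> ~ B q -> f p q (b p) = 0
    & forall p q, ple p q -> ~ B p -> B q -> forall u, r q (f p q u) = 0].

Hypothesis fM : is_pmodule f.

Lemma pmodule_id p (v : V p) : f p p v = v.
Proof. by rewrite fM.1 id_lfunE. Qed.

Lemma pmodule_comp p q r (v : V p) :
  ple p q -> ple q r -> f q r (f p q v) = f p r v.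
Proof. by move=> pq qr; rewrite (fM.2 _ _ _ pq qr) comp_lfunE. Qed.

Lemma ple_refl (p : S * T) : ple p p.
Proof. by split. Qed.

Lemma ple_trans (p q r : S * T) : ple p q -> ple q r -> ple p r.
Proof. by move=> [? ?] [? ?]; split; apply: le_trans; eauto. Qed.

Let meet (p q : S * T) : S * T := (Order.min p.1 q.1, Order.min p.2 q.2).
Let join (p q : S * T) : S * T := (Order.max p.1 q.1, Order.max p.2 q.2).

Let meet_l p q : ple (meet p q) p.
Proof. by split; rewrite /= ge_min lexx. Qed.
Let meet_r p q : ple (meet p q) q.
Proof. by split; rewrite /= ge_min lexx orbT. Qed.
Let join_l p q : ple p (join p q).
Proof. by split; rewrite /= le_max lexx. Qed.
Let join_r p q : ple q (join p q).
Proof. by split; rewrite /= le_max lexx orbT. Qed.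
Let le_meet p q r : ple r p -> ple r q -> ple r (meet p q).
Proof. by move=> [? ?] [? ?]; split; rewrite /= le_min; apply/andP. Qed.
Let join_le p q r : ple p r -> ple q r -> ple (join p q) r.
Proof. by move=> [? ?] [? ?]; split; rewrite /= ge_max; apply/andP. Qed.

(** Below [(x, y)] the lifts of [v] that die outside [B] form affine sets; above it so do the
    functionals that take 1 on the image of [v] and vanish on what comes from outside. A rectangle
    is closed under meets and joins, so both systems are directed and compatible choices [w] and
    [rho] exist. *)
Lemma rectangle_summand (JS : S -> Prop) (JT : T -> Prop) (x : S) (y : T)
    (v : V (x, y)) (B := fun p : S * T => JS p.1 /\ JT p.2) :
  JS x -> JT y ->
  (forall p, B p -> ple p (x, y) ->
     exists u : V p, f p (x, y) u = v /\
       forall q, ple p q -> ~ B q -> f p q u = 0) ->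
  (forall p, B p -> ple (x, y) p ->
     exists rho : 'Hom(V p, K^o), rho (f (x, y) p v) = 1 /\
       forall q, ple q p -> ~ B q -> forall u, rho (f q p u) = 0) ->
  exists b r, is_block_summand B b r.
Proof.
set p0 := (x, y); move=> JSx JTy hv hr.
have Bmeet p q : B p -> B q -> B (meet p q).
  by move=> [? ?] [? ?]; split=> /=; case: leP.
have Bjoin p q : B p -> B q -> B (join p q).
  by move=> [? ?] [? ?]; split=> /=; case: leP.
have B0 : B p0 by [].
have [|||||||w [wA wC]] := @affine_inverse_limit_nonempty K (S * T)%type
    (fun p => B p /\ ple p p0) (fun p q => ple q p) V (fun i j => f j i)
    (fun p u => f p p0 u = v /\ forall q, ple p q -> ~ B q -> f p q u = 0).
- by move=> i j a u u'; rewrite linearP.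
- by move=> i j k ij jk; apply: ple_trans jk ij.
- by move=> i j k u ij jk; rewrite pmodule_comp.
- move=> i j [Bi i0] [Bj j0]; exists (meet i j); split=> //.
  by split; [exact: Bmeet|apply: ple_trans i0].
- move=> i [Bi i0] a b c l [ea ka] [eb kb] [ec kc]; split.
    by rewrite linearP linearB /= ea eb ec subrr scaler0 add0r.
  by move=> q iq nBq; rewrite linearP linearB /= ka ?kb ?kc // subrr scaler0 add0r.
- move=> i j u [Bi i0] [Bj j0] ij [eu ku]; split; first by rewrite pmodule_comp.
  by move=> q iq nBq; rewrite pmodule_comp // ku //; apply: ple_trans iq.
- by move=> i [Bi i0]; apply: hv.
have [|||||||rho [rA rC]] := @affine_inverse_limit_nonempty K (S * T)%type
    (fun p => B p /\ ple p0 p) (@ple _ _ S T) (fun p => 'Hom(V p, K^o))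
    (fun i j rho => (rho \o f i j)%VF)
    (fun p rho => rho (f p0 p v) = 1 /\
       forall q, ple q p -> ~ B q -> forall u, rho (f q p u) = 0).
- by move=> i j a u u'; rewrite comp_lfunDl comp_lfunZl.
- exact: ple_trans.
- by move=> i j k u ij jk; apply/lfunP => z; rewrite !comp_lfunE pmodule_comp.
- move=> i j [Bi i0] [Bj j0]; exists (join i j); split=> //.
  by split; [exact: Bjoin|apply: ple_trans (join_l _ _)].
- move=> i [Bi i0] a b c l [ea ka] [eb kb] [ec kc]; split.
    by rewrite !lfunE /= lfunE /= lfunE /= opp_lfunE ea eb ec subrr scaler0 add0r.
  move=> q iq nBq u.
  by rewrite !lfunE /= lfunE /= lfunE /= opp_lfunE ka ?kb ?kc // subrr scaler0 add0r.
- move=> i j u [Bi i0] [Bj j0] ij [eu ku]; split.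
    by rewrite comp_lfunE pmodule_comp.
  by move=> q qi nBq z; rewrite comp_lfunE pmodule_comp // ku //; apply: ple_trans ij.
- by move=> i [Bi i0]; apply: hr.
have wM p : B p -> B (meet p p0) /\ ple (meet p p0) p0 by split; [exact: Bmeet|].
have rJ p : B p -> B (join p p0) /\ ple p0 (join p p0) by split; [exact: Bjoin|].
(* Any point of [B], comparable with [p0] or not, gets its generator from the meet with [p0] and its
   functional from the join. The map from meet to join also passes through [p0], which yields the
   value 1. *)
pose b p : V p := if pselect (B p) then f (meet p p0) p (w (meet p p0)) else 0.
pose r p : 'Hom(V p, K^o) := if pselect (B p) then
  (rho (join p p0) \o f p (join p p0))%VF else 0.
have bB p : B p -> b p = f (meet p p0) p (w (meet p p0)).
  by rewrite /b; case: pselect.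
have bN p : ~ B p -> b p = 0 by rewrite /b; case: pselect.
have rB p u : B p -> r p u = rho (join p p0) (f p (join p p0) u).
  by rewrite /r; case: pselect => //= _; rewrite comp_lfunE.
have rN p u : ~ B p -> r p u = 0.
  by rewrite /r; case: pselect => //= _; rewrite zero_lfunE.
exists b, r; split.
- move=> p Bp; rewrite bB // rB // pmodule_comp //.
  have [e1 _] := rA _ (rJ _ Bp); have [e2 _] := wA _ (wM _ Bp).
  by rewrite -e1 -e2 pmodule_comp // -(@pmodule_comp _ p).
- by move=> p nBp; rewrite bN //; split=> // u; exact: rN.
- move=> p q pq Bp Bq; split=> [|u].
    have mm : ple (meet p p0) (meet q p0) by apply: le_meet => //; apply: ple_trans pq.
    rewrite !bB // pmodule_comp // -(wC _ _ (wM _ Bq) (wM _ Bp)) //.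
    by rewrite pmodule_comp.
  have jj : ple (join p p0) (join q p0) by apply: join_le => //; apply: ple_trans (join_l _ _).
  rewrite !rB // pmodule_comp // -(rC _ _ (rJ _ Bp) (rJ _ Bq)) //.
  by rewrite comp_lfunE pmodule_comp.
- move=> p q pq Bp nBq; rewrite bB // pmodule_comp //.
  by have [_ ->] := wA _ (wM _ Bp) => //; apply: ple_trans pq.
- move=> p q pq nBp Bq u; rewrite rB // pmodule_comp //.
  by have [_ ->] := rA _ (rJ _ Bq) => //; apply: ple_trans (join_l _ _).
Qed.

End BlockSummand.

(** * Exchange of the two factors *)

Section Swap.
Variables (K : fieldType) (dS dT : Order.disp_t)
          (S : orderType dS) (T : orderType dT).
Variables (V : S * T -> vectType K) (f : forall p q : S * T, 'Hom(V p, V q)).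

Definition swapV (p : T * S) : vectType K := V (p.2, p.1).
Definition swapf (p q : T * S) : 'Hom(swapV p, swapV q) := f (p.2, p.1) (q.2, q.1).

Lemma swap_pmodule : is_pmodule f -> is_pmodule swapf.
Proof.
move=> [f1 fC]; split=> [p|p q r [? ?] [? ?]]; first exact: f1.
by apply: fC; split.
Qed.

Lemma swap_middle_exact : middle_exact f -> middle_exact swapf.
Proof.
move=> fE x x' y y' xx' yy' /= u w; rewrite /swapf /=.
have h := fE y y' x x' yy' xx' w u; split=> [e|[v [e1 e2]]].
  have [|v [e1 e2]] := h.1; last by exists v.
  by rewrite -opprB; apply/eqP; rewrite oppr_eq0 e.
by rewrite -opprB; apply/eqP; rewrite oppr_eq0; apply/eqP/h; exists v.
Qed.

Lemma swap_is_block (B : T * S -> Prop) :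
  is_block B -> is_block (fun p : S * T => B (p.2, p.1)).
Proof.
case=> [[JT [JS [? [? h]]]]|[[JT [JS [? [? h]]]]|[[J [? h]]|[J [? h]]]]].
- by left; exists JS, JT; do 2!split=> //; move=> p; rewrite h /= and_comm.
- by right; left; exists JS, JT; do 2!split=> //; move=> p; rewrite h /= and_comm.
- by right; right; right; exists J; split=> // p; rewrite h.
- by right; right; left; exists J; split=> // p; rewrite h.
Qed.

End Swap.

Definition has_block_summand (K : fieldType) (dS dT : Order.disp_t)
    (S : orderType dS) (T : orderType dT) (V : S * T -> vectType K)
    (f : forall p q : S * T, 'Hom(V p, V q)) (p : S * T) : Prop :=
  exists B b r, [/\ is_block B, B p & is_block_summand f B b r].

Lemma swap_has_block_summand (K : fieldType) (dS dT : Order.disp_t)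
    (S : orderType dS) (T : orderType dT) (V : S * T -> vectType K)
    (f : forall p q : S * T, 'Hom(V p, V q)) (x : S) (y : T) :
  has_block_summand (swapf f) (y, x) -> has_block_summand f (x, y).
Proof.
move=> [B [b [r [Bb Bp [h1 h2 h3 h4 h5]]]]].
exists (fun p => B (p.2, p.1)).
(* The match is needed for typing: [swapV (t, s)] converts to [V p] only once [p] is a pair. *)
exists (fun p => let: (s, t) := p return V p in b (t, s)).
exists (fun p => let: (s, t) := p return 'Hom(V p, K^o) in r (t, s)).
split=> //; first exact: swap_is_block.
split=> [[s t]|[s t]|[s t] [s' t'] [/= ? ?]|[s t] [s' t'] [/= ? ?]|[s t] [s' t'] [/= ? ?]] /=.
- exact: h1.
- exact: h2.
- by apply: (h3 (t, s) (t', s')).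
- by apply: (h4 (t, s) (t', s')).
- by apply: (h5 (t, s) (t', s')).
Qed.

(** * Transport of lifts and functionals along a row *)

Section Lifting.
Variables (K : fieldType) (dS dT : Order.disp_t)
          (S : orderType dS) (T : orderType dT).
Variables (V : S * T -> vectType K) (f : forall p q : S * T, 'Hom(V p, V q)).
Hypothesis fM : is_pmodule f.
Hypothesis fE : middle_exact f.

Lemma square_lift x x' y y' (u : V (x, y')) (w : V (x', y)) :
  (x <= x')%O -> (y <= y')%O ->
  f (x, y') (x', y') u = f (x', y) (x', y') w ->
  exists v : V (x, y), f (x, y) (x, y') v = u /\ f (x, y) (x', y) v = w.
Proof. by move=> xx' yy' e; apply/(fE xx' yy'); rewrite /= e subrr. Qed.

Lemma lker_mono p q r : ple p q -> ple q r -> (lker (f p q) <= lker (f p r))%VS.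
Proof.
move=> pq qr; apply/subvP => v; rewrite !memv_ker => /eqP e.
by rewrite -(pmodule_comp fM _ pq qr) e linear0.
Qed.

Lemma limg_mono p q r : ple p q -> ple q r -> (limg (f p r) <= limg (f q r))%VS.
Proof.
move=> pq qr; apply/subvP => _ /memv_imgP[v _ ->].
by rewrite -(pmodule_comp fM _ pq qr) memv_img ?memvf.
Qed.

(** The kernels of the upward maps out of [(s, y)] grow with the target, so those indexed by [Q]
    have a smallest one, at [t1]. Gluing 0 and [v] over the square with top row [t1] gives a lift in
    that kernel, hence in all of them. *)
Lemma lift_left (s x : S) (y : T) (Q : T -> Prop) (v : V (x, y)) :
  (s <= x)%O -> (forall t, Q t -> (y <= t)%O) -> (exists t, Q t) ->
  (forall t, Q t -> f (x, y) (x, t) v = 0) ->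
  exists u : V (s, y), f (s, y) (x, y) u = v /\
    forall t, Q t -> f (s, y) (s, t) u = 0.
Proof.
move=> sx Qy exQ kv.
have [t1 [Qt1 min1]] := exists_minimizer (fun t => \dim (lker (f (s, y) (s, t)))) exQ.
have [|u [u0 uv]] := @square_lift s x y t1 0 v sx (Qy _ Qt1).
  by rewrite linear0 kv.
exists u; split=> // t Qt; apply/eqP; rewrite -memv_ker.
have u1 : u \in lker (f (s, y) (s, t1)) by rewrite memv_ker u0.
have [le|/ltW le] := leP t1 t.
  by apply: (subvP (lker_mono _ _) u u1); split=> //=; apply: Qy.
suff /eqP -> : lker (f (s, y) (s, t)) == lker (f (s, y) (s, t1)) by [].
by rewrite eqEdim min1 // andbT; apply: lker_mono; split=> //=; apply: Qy.
Qed.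

(** Dually, the images in [V (x1, y)] from rows of [Q] have a largest one, at [t1]. By exactness its
    preimage in [V (x, y)] comes from [(x, t1)], where [r] vanishes, so [r] extends by zero on
    it. *)
Lemma extend_right (x x1 : S) (y : T) (Q : T -> Prop) (r : 'Hom(V (x, y), K^o)) :
  (x <= x1)%O -> (forall t, Q t -> (t <= y)%O) -> (exists t, Q t) ->
  (forall t, Q t -> forall z, r (f (x, t) (x, y) z) = 0) ->
  exists rho : 'Hom(V (x1, y), K^o), (forall u, rho (f (x, y) (x1, y) u) = r u) /\
    forall t, Q t -> forall z, rho (f (x1, t) (x1, y) z) = 0.
Proof.
move=> xx1 Qy exQ kr.
have [t1 [Qt1 max1]] := exists_maximizer
  (fun t => dimvS (subvf (limg (f (x1, t) (x1, y))))) exQ.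
have [w|rho [rE rZ]] := @functional_extension K _ _ _ (f (x, y) (x1, y))
    (limg (f (x1, t1) (x1, y))) r.
  case/memv_imgP => z _ e.
  by have [v [<- _]] := square_lift xx1 (Qy _ Qt1) e; apply: kr.
exists rho; split=> // t Qt z; apply: rZ.
have zt : f (x1, t) (x1, y) z \in limg (f (x1, t) (x1, y)) by rewrite memv_img ?memvf.
have [le|/ltW le] := leP t t1.
  by apply: (subvP (limg_mono _ _) _ zt); split=> //=; apply: Qy.
suff /eqP -> : limg (f (x1, t1) (x1, y)) == limg (f (x1, t) (x1, y)) by [].
by rewrite eqEdim max1 // andbT; apply: limg_mono; split=> //=; apply: Qy.
Qed.

End Lifting.

(** * Block summands through a given point *)

Section PointCases.
Variables (K : fieldType) (dS dT : Order.disp_t)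
          (S : orderType dS) (T : orderType dT).
Variables (V : S * T -> vectType K) (f : forall p q : S * T, 'Hom(V p, V q)).
Hypothesis fM : is_pmodule f.
Hypothesis fE : middle_exact f.

Let fC p q r v := @pmodule_comp _ _ _ _ _ _ _ fM p q r v.
Arguments fC : clear implicits.

Lemma lift_down (x : S) (t y : T) (Q : S -> Prop) (v : V (x, y)) :
  (t <= y)%O -> (forall s, Q s -> (x <= s)%O) -> (exists s, Q s) ->
  (forall s, Q s -> f (x, y) (s, y) v = 0) ->
  exists u : V (x, t), f (x, t) (x, y) u = v /\
    forall s, Q s -> f (x, t) (s, t) u = 0.
Proof.
exact: (@lift_left K dT dS T S _ _ (swap_pmodule fM) (swap_middle_exact fE) t y x Q v).
Qed.

Lemma extend_up (x : S) (y y1 : T) (Q : S -> Prop) (r : 'Hom(V (x, y), K^o)) :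
  (y <= y1)%O -> (forall s, Q s -> (s <= x)%O) -> (exists s, Q s) ->
  (forall s, Q s -> forall z, r (f (s, y) (x, y) z) = 0) ->
  exists rho : 'Hom(V (x, y1), K^o), (forall u, rho (f (x, y) (x, y1) u) = r u) /\
    forall s, Q s -> forall z, rho (f (s, y1) (x, y1) z) = 0.
Proof.
exact: (@extend_right K dT dS T S _ _ (swap_pmodule fM) (swap_middle_exact fE) y y1 x Q r).
Qed.

Variables (x : S) (y : T).

(** The row [t1] has the smallest upward kernel among those meeting [K0], and [v] is a nonzero
    common vector. For rows of [JT] above [y] the upward kernel then meets [K0] in 0, which keeps
    [v] alive all over the rectangle. *)
Lemma death_block_summand (s0 : S) (t0 : T) :
  (x <= s0)%O -> (y <= t0)%O ->
  (lker (f (x, y) (s0, y)) :&: lker (f (x, y) (x, t0)) != 0)%VS ->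
  has_block_summand f (x, y).
Proof.
move=> xs0 yt0 n0.
pose K0 := lker (f (x, y) (s0, y)).
have [|t1 [[yt1 nz1] min1]] := @exists_minimizer T
    (fun t => (y <= t)%O /\ (K0 :&: lker (f (x, y) (x, t)) != 0)%VS)
    (fun t => \dim (lker (f (x, y) (x, t)))).
  by exists t0.
have [v [vK vL v0]] : exists v, [/\ v \in K0, f (x, y) (x, t1) v = 0 & v != 0].
  exists (vpick (K0 :&: lker (f (x, y) (x, t1)))); rewrite vpick0 nz1.
  by have := memv_pick (K0 :&: lker (f (x, y) (x, t1))); rewrite memv_cap => /andP[-> /[!memv_ker]/eqP ->].
pose JS s := ~ ((x <= s)%O /\ f (x, y) (s, y) v = 0).
pose JT t := ~ ((y <= t)%O /\ f (x, y) (x, t) v = 0).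
have fvx : f (x, y) (x, y) v <> 0 by rewrite (pmodule_id fM); apply/eqP.
have JSx : JS x by case.
have JTy : JT y by case.
have idS : interval_ideal JS.
  split; first by exists x.
  move=> s s' s's Js [xs' e]; apply: Js; split; first exact: le_trans s's.
  by rewrite -(fC _ (s', y)) ?e ?linear0.
have idT : interval_ideal JT.
  split; first by exists y.
  move=> t t' t't Jt [yt' e]; apply: Jt; split; first exact: le_trans t't.
  by rewrite -(fC _ (x, t')) ?e ?linear0.
have nJS0 : ~ JS s0 by apply; split=> //; apply/eqP; rewrite -memv_ker.
have nJT1 : ~ JT t1 by apply.
have [||b [r br]] := rectangle_summand fM (v := v) JSx JTy.
(* Lift first to the left, still dying upwards, then down, still dying to the right; the second lift
   inherits the upward vanishing from the first. *)
- move=> [s t] _ [/= sx ty].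
  have [||| u1 [u1v ku1]] := @lift_left _ _ _ _ _ _ _ fM fE s x y (fun t => ~ JT t) v sx.
  + by move=> t' /contrapT[].
  + by exists t1.
  + by move=> t' /contrapT[].
  have [||| u [uu1 ku]] := @lift_down s t y (fun s' => ~ JS s') u1 ty.
  + by move=> s' /contrapT[xs' _]; apply: le_trans xs'.
  + by exists s0.
  + move=> s' /contrapT[xs' e].
    by rewrite -(fC _ (x, y)) ?u1v.
  exists u; split.
    by rewrite -(fC _ (s, y)) ?uu1.
  move=> [q1 q2] [/= sq1 tq2] /not_andP[] /= nJ.
    by rewrite -(fC _ (q1, t)) ?ku ?linear0.
  have [yq2 _] := contrapT nJ.
  rewrite -(fC _ (s, q2)) //.
  by rewrite -(fC (s, t) (s, y)) // uu1 ku1 ?linear0.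
- move=> [s t] [/= Js Jt] [/= xs yt].
  have fv0 : f (x, y) (s, t) v != 0.
    (* If [v] died at [(s, t)], exactness would give [v'] dying along the row with [v - v'] dying
       along the column. Then [v - v'] lies in [K0] and in the upward kernel, so it is 0 and [v]
       dies at [(s, y)]. *)
    apply/eqP => e.
    have [|v' [e1 e2]] := @square_lift _ _ _ _ _ _ _ fE x s y t (f _ _ v) 0 xs yt.
      by rewrite linear0 (pmodule_comp fM).
    have ss0 : (s <= s0)%O.
      rewrite leNgt; apply/negP => /ltW s0s; apply: Js; split=> //.
      apply/eqP; rewrite -memv_ker; apply: (subvP (lker_mono fM _ _) _ vK) => //.
    have v'K : v' \in K0.
      by apply: (subvP (@lker_mono _ _ _ _ _ _ _ fM _ (s, y) _ _ _)); rewrite ?memv_ker ?e2.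
    have tt1 : (t <= t1)%O.
      rewrite leNgt; apply/negP => /ltW t1t; apply: Jt; split=> //.
      by rewrite -(fC _ (x, t1)) // vL linear0.
    have KL0 : (K0 :&: lker (f (x, y) (x, t)) == 0)%VS.
      apply: contrapT => /negP nz; apply: Jt; split=> //.
      suff /eqP e3 : lker (f (x, y) (x, t)) == lker (f (x, y) (x, t1)).
        by apply/eqP; rewrite -memv_ker e3 memv_ker vL.
      by rewrite eqEdim min1 // andbT; apply: lker_mono.
    have : v - v' \in (K0 :&: lker (f (x, y) (x, t)))%VS.
      by rewrite memv_cap memvB //= memv_ker linearB /= e1 subrr.
    rewrite (eqP KL0) memv0 subr_eq0 => /eqP e3.
    by apply: Js; split=> //; rewrite e3.
  (* [B] is closed downwards, so nothing from outside reaches [(s, t)] and any functional detecting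
     the image of [v] will do. *)
  have [|rho [r1 _]] := @separating_functional K (V (s, t)) 0%VS (f (x, y) (s, t) v).
    by rewrite memv0.
  exists rho; split=> // -[q1 q2] [/= q1s q2t] nB; case: nB; split=> /=.
    exact: (idS.2 _ _ q1s).
  exact: (idT.2 _ _ q2t).
exists (fun p => JS p.1 /\ JT p.2), b, r; split=> //.
by left; exists JS, JT.
Qed.

(** Dual to the death case: a functional [r] is fixed first, vanishing on the image from [s0] and on
    the largest vertical image that leaves the sum proper. The generator [v] is found afterwards. *)
Lemma birth_block_summand (s0 : S) (t0 : T) :
  (s0 <= x)%O -> (t0 <= y)%O ->
  (limg (f (s0, y) (x, y)) + limg (f (x, t0) (x, y)) != fullv)%VS ->
  has_block_summand f (x, y).
Proof.
move=> s0x t0y n0.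
pose I0 := limg (f (s0, y) (x, y)).
have [|t1 [[t1y nz1] max1]] := exists_maximizer
    (P := fun t => (t <= y)%O /\ (I0 + limg (f (x, t) (x, y)) != fullv)%VS)
    (fun t => dimvS (subvf (limg (f (x, t) (x, y))))).
  by exists t0.
have [r [[v0 rv0] rI rH]] : exists r : 'Hom(V (x, y), K^o), [/\ exists v0, r v0 = 1,
    forall z, r (f (s0, y) (x, y) z) = 0 & forall z, r (f (x, t1) (x, y) z) = 0].
  have [v0 v0N] : exists v0, v0 \notin (I0 + limg (f (x, t1) (x, y)))%VS.
    apply: contrapT => /forallNP h; case/negP: nz1; apply/eqP/vspaceP => w.
    by rewrite memvf; apply: contrapT => /negP; apply: h.
  have [r [rv0 rZ]] := separating_functional v0N.
  exists r; split=> [|z|z]; first by exists v0.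
    by apply: rZ; apply: (subvP (addvSl _ _)); rewrite memv_img ?memvf.
  by apply: rZ; apply: (subvP (addvSr _ _)); rewrite memv_img ?memvf.
pose JS s := ~ ((s <= x)%O /\ forall z, r (f (s, y) (x, y) z) = 0).
pose JT t := ~ ((t <= y)%O /\ forall z, r (f (x, t) (x, y) z) = 0).
have rx : ~ forall z, r (f (x, y) (x, y) z) = 0.
  move=> /(_ v0); rewrite (pmodule_id fM) rv0 => /eqP; by rewrite oner_eq0.
have JSx : JS x by case.
have JTy : JT y by case.
have fiS : interval_filter JS.
  split; first by exists x.
  move=> s s' ss' Js [s'x e]; apply: Js; split; first exact: le_trans s'x.
  by move=> z; rewrite -(fC _ (s', y)).
have fiT : interval_filter JT.
  split; first by exists y.
  move=> t t' tt' Jt [t'y e]; apply: Jt; split; first exact: le_trans t'y.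
  by move=> z; rewrite -(fC _ (x, t')).
have nJS0 : ~ JS s0 by apply.
have nJT1 : ~ JT t1 by apply.
have rnz s t : JS s -> JT t -> (s <= x)%O -> (t <= y)%O ->
    exists z, r (f (s, t) (x, y) z) != 0.
  move=> Js Jt sx ty; have [z1 rz1] : exists z1, r (f (s, y) (x, y) z1) != 0.
    apply: contrapT => /forallNP h; apply: Js; split=> // z.
    by apply/eqP; apply: contrapT => /negP; apply: h.
  have s0s : (s0 <= s)%O.
    rewrite leNgt; apply/negP => /ltW ss0; apply: Js; split=> // z.
    by rewrite -(fC _ (s0, y)).
  have t1t : (t1 <= t)%O.
    rewrite leNgt; apply/negP => /ltW tt1; apply: Jt; split=> // z.
    by rewrite -(fC _ (x, t1)).
  have full : (I0 + limg (f (x, t) (x, y)) == fullv)%VS.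
    apply: contrapT => /negP nz; apply: Jt; split=> // z.
    have /eqP e3 : limg (f (x, t1) (x, y)) == limg (f (x, t) (x, y)).
      by rewrite eqEdim max1 // andbT; apply: limg_mono.
    have : f (x, t) (x, y) z \in limg (f (x, t) (x, y)) by rewrite memv_img ?memvf.
    by rewrite -e3 => /memv_imgP[z' _ ->].
  (* Split the image of [z1], where [r] is nonzero, along this full sum. Removing the part in [I0],
     on which [r] vanishes, leaves a vector that also comes from [(x, t)] and hence lifts to
     [(s, t)]. *)
  have : f (s, y) (x, y) z1 \in (I0 + limg (f (x, t) (x, y)))%VS.
    by rewrite (eqP full) memvf.
  case/memv_addP => _ /memv_imgP[z2 _ ->] [_ /memv_imgP[z3 _ ->] e].
  have [|z [e1 _]] := @square_lift _ _ _ _ _ _ _ fE s x t y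
      (z1 - f (s0, y) (s, y) z2) z3 sx ty.
    by rewrite linearB /= e fC // addrC addKr.
  exists z; rewrite -(fC _ (s, y)) // e1 linearB /= fC // linearB /= rI.
  by rewrite subr0.
(* The image from [(s1, t2)] is smallest among those from points of [B] below [(x, y)], as passing
   to meets shows; so [v], taken from it and scaled to [r v = 1], lifts to all of them. *)
have [|[s1 t2] [[[/= Js1 Jt2] [/= s1x t2y]] min1]] := @exists_minimizer (S * T)%type
    (fun p => (JS p.1 /\ JT p.2) /\ ple p (x, y))
    (fun p => \dim (limg (f p (x, y)))).
  by exists (x, y).
have [z rz] := rnz _ _ Js1 Jt2 s1x t2y.
pose c : K := r (f (s1, t2) (x, y) z); pose v := c^-1 *: f (s1, t2) (x, y) z.
have rv : r v = 1 by rewrite linearZ /=; exact: mulVf.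
have vI : v \in limg (f (s1, t2) (x, y)) by rewrite /v memvZ // memv_img ?memvf.
have [||b [r' br]] := rectangle_summand fM (v := v) JSx JTy.
- move=> [s t] [/= Js Jt] [/= sx ty].
  pose q := (Order.min s s1, Order.min t t2).
  have q1 : ple q (s, t) by split; rewrite /= ge_min lexx.
  have q2 : ple q (s1, t2) by split; rewrite /= ge_min lexx orbT.
  have /eqP e : limg (f q (x, y)) == limg (f (s1, t2) (x, y)).
    rewrite eqEdim limg_mono //= min1 //; split; last exact: ple_trans q1 _.
    by split=> /=; case: leP.
  have : v \in limg (f (s, t) (x, y)).
    by apply: (subvP (@limg_mono _ _ _ _ _ _ _ fM q _ _ _ _)) => //; rewrite e.
  case/memv_imgP => u _ ->; exists u; split=> // -[q3 q4] [/= sq tq] nB.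
  by case: nB; split; [exact: (fiS.2 _ _ sq) | exact: (fiT.2 _ _ tq)].
- move=> [x1 y1] [/= J1 J2] [/= xx1 yy1].
  have [|||rho1 [r1E r1Z]] := @extend_right _ _ _ _ _ _ _ fM fE x x1 y (fun t => ~ JT t) r xx1.
  + by move=> t /contrapT[].
  + by exists t1.
  + by move=> t /contrapT[].
  have [|||rho [rE rZ]] := @extend_up x1 y y1 (fun s => ~ JS s) rho1 yy1.
  + by move=> s /contrapT[sx _]; apply: le_trans xx1.
  + by exists s0.
  + by move=> s /contrapT[sx rs] w; rewrite -(fC _ (x, y)) // r1E.
  exists rho; split.
    by rewrite -(fC _ (x1, y)) // rE r1E.
  move=> [q1 q2] [/= q1x q2y] /not_andP[] /= nJ u.
    by rewrite -(fC _ (q1, y1)) // rZ.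
  have [q2y' _] := contrapT nJ.
  by rewrite -(fC _ (x1, q2)) // -(fC (x1, q2) (x1, y)) // rE r1Z.
exists (fun p => JS p.1 /\ JT p.2), b, r'; split=> //.
by right; left; exists JS, JT.
Qed.

(** Detects [v] at the points of a vertical band above [(x, y)]. Of the images from excluded columns
    only the largest, at [s1], matters; were the image of [v] in it, gluing and injectivity along
    the row would put [v] itself into the image from [(s1, y)]. *)
Lemma band_functional (JS : S -> Prop) (v : V (x, y)) (x1 : S) (y1 : T) :
  (x <= x1)%O -> (y <= y1)%O ->
  lker (f (x, y) (x1, y)) = 0%VS ->
  (forall s, (s <= x1)%O -> ~ JS s ->
     (s <= x)%O /\ v \notin limg (f (s, y) (x, y))) ->
  (exists s, (s <= x1)%O /\ ~ JS s) ->
  exists rho : 'Hom(V (x1, y1), K^o), rho (f (x, y) (x1, y1) v) = 1 /\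
    forall q, ple q (x1, y1) -> ~ (JS q.1 /\ True) ->
      forall u, rho (f q (x1, y1) u) = 0.
Proof.
move=> xx1 yy1 K0 vN exN.
have [s1 [[s1x nJ1] max1]] := exists_maximizer
  (fun s => dimvS (subvf (limg (f (s, y1) (x1, y1))))) exN.
have vn : f (x, y) (x1, y1) v \notin limg (f (s1, y1) (x1, y1)).
  apply/negP => /memv_imgP[z _ e]; have [sx] := vN _ s1x nJ1; case/negP.
  have [|z' [_ e']] := @square_lift _ _ _ _ _ _ _ fE s1 x1 y y1 z
      (f (x, y) (x1, y) v) s1x yy1; first by rewrite fC.
  have /eqP : f (s1, y) (x, y) z' - v == 0.
    by rewrite -memv0 -K0 memv_ker linearB /= fC // e' subrr.
  by move=> /subr0_eq <-; rewrite memv_img ?memvf.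
have [rho [r1 rZ]] := separating_functional vn.
exists rho; split=> // -[q1 q2] [/= q1x q2y] nJ u; apply: rZ.
have {}nJ : ~ JS q1 by move=> J; apply: nJ.
have : f (q1, q2) (x1, y1) u \in limg (f (q1, y1) (x1, y1)).
  by rewrite -(fC _ (q1, y1)) // memv_img ?memvf.
have [le|/ltW le] := leP q1 s1.
  by apply: (subvP (limg_mono fM _ _)).
suff /eqP -> : limg (f (s1, y1) (x1, y1)) == limg (f (q1, y1) (x1, y1)) by [].
by rewrite eqEdim max1 // andbT; apply: limg_mono.
Qed.

Lemma image_meet (s : S) (t : T) (v : V (x, y)) :
  (s <= x)%O -> (t <= y)%O ->
  v \in limg (f (s, y) (x, y)) -> v \in limg (f (x, t) (x, y)) ->
  exists u, f (s, t) (x, y) u = v.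
Proof.
move=> sx ty /memv_imgP[u1 _ e1] /memv_imgP[u2 _ e2].
have [|u [e3 _]] := @square_lift _ _ _ _ _ _ _ fE s x t y u1 u2 sx ty.
  by rewrite -e1 -e2.
by exists u; rewrite -(fC _ (s, y)) // e3 -e1.
Qed.

Lemma kernel_join (s : S) (t : T) (v : V (x, y)) :
  (x <= s)%O -> (y <= t)%O -> f (x, y) (s, t) v = 0 ->
  exists v', f (x, y) (s, y) v' = 0 /\ f (x, y) (x, t) (v - v') = 0.
Proof.
move=> xs yt e.
have [|v' [e1 e2]] := @square_lift _ _ _ _ _ _ _ fE x s y t (f _ _ v) 0 xs yt.
  by rewrite linear0 fC.
by exists v'; split=> //; rewrite linearB /= e1 subrr.
Qed.

(** By the last hypothesis a nonzero vector that dies to the right survives upwards, so a vertical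
    band can be expected. Taking [v] in the smallest nonzero kernel makes the row maps injective as
    far as [v] survives. *)
Lemma kernel_band_summand (s0 : S) :
  (x <= s0)%O -> lker (f (x, y) (s0, y)) != 0%VS ->
  (forall s t, (x <= s)%O -> (y <= t)%O ->
    (lker (f (x, y) (s, y)) :&: lker (f (x, y) (x, t)) = 0)%VS) ->
  has_block_summand f (x, y).
Proof.
move=> xs0 n0 KL0.
have [|s1 [[xs1 nz1] min1]] := @exists_minimizer S
    (fun s => (x <= s)%O /\ lker (f (x, y) (s, y)) != 0%VS)
    (fun s => \dim (lker (f (x, y) (s, y)))).
  by exists s0.
set K1 := lker (f (x, y) (s1, y)) in nz1 min1.
have [v [vK v0]] : exists v, v \in K1 /\ v != 0.
  by exists (vpick K1); rewrite vpick0 memv_pick.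
pose JS s := ((x <= s)%O -> f (x, y) (s, y) v <> 0) /\
             ((s <= x)%O -> v \in limg (f (s, y) (x, y))).
have JSx : JS x.
  split=> _; first by rewrite (pmodule_id fM); apply/eqP.
  by rewrite -[v](pmodule_id fM) memv_img ?memvf.
have vmono s s' : (x <= s)%O -> (s <= s')%O -> f (x, y) (s, y) v = 0 ->
    f (x, y) (s', y) v = 0.
  by move=> xs ss' e; rewrite -(fC _ (s, y)) // e linear0.
have imono s s' : (s <= s')%O -> (s' <= x)%O -> v \in limg (f (s, y) (x, y)) ->
    v \in limg (f (s', y) (x, y)).
  by move=> ss' s'x; apply: (subvP (limg_mono fM _ _)).
have K0 s : JS s -> (x <= s)%O -> lker (f (x, y) (s, y)) = 0%VS.
  move=> [/(_ _) Js _] xs; have {}Js := Js xs.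
  have ss1 : (s <= s1)%O.
    rewrite leNgt; apply/negP => /ltW s1s; apply: Js; apply: vmono s1s _ => //.
    by apply/eqP; rewrite -memv_ker.
  apply/eqP; apply: contrapT => /negP nz; apply: Js.
  have /eqP e : lker (f (x, y) (s, y)) == K1.
    by rewrite eqEdim min1 // andbT; apply: lker_mono.
  by apply/eqP; rewrite -memv_ker e.
have vs1 : f (x, y) (s1, y) v = 0 by apply/eqP; rewrite -memv_ker.
have iJ : Defs.interval JS.
  split; first by exists x.
  move=> a c d ac cd [Ja1 Ja2] [Jd1 Jd2]; split=> [xc e|cx].
    by apply: (Jd1 _ (vmono _ _ xc cd e)); apply: le_trans cd.
  by apply: (imono _ _ ac cx); apply: Ja2; apply: le_trans cx.
have [||b [r br]] := rectangle_summand fM (JT := fun _ => True) (v := v) JSx I.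
- move=> [s t] [/= [Js1 Js2] _] [/= sx ty].
  case/memv_imgP: (Js2 sx) => u1 _ vE.
  have [|||u [uu1 ku]] := @lift_down s t y
      (fun s' => (x <= s')%O /\ f (x, y) (s', y) v = 0) u1 ty.
  + by move=> s' [xs' _]; apply: le_trans xs'.
  + by exists s1.
  + by move=> s' [xs' e]; rewrite -(fC _ (x, y)) // -vE.
  exists u; split; first by rewrite -(fC _ (s, y)) // uu1 -vE.
  move=> [q1 q2] [/= sq1 tq2] nB.
  suff Qq : (x <= q1)%O /\ f (x, y) (q1, y) v = 0.
    by rewrite -(fC _ (q1, t)) // ku ?linear0.
  have {nB} /not_andP[] : ~ JS q1 by move=> J; apply: nB.
    by move/not_implyP => [? /contrapT].
  move/not_implyP => [q1x]; case; exact: imono (Js2 sx).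
- move=> [x1 y1] [/= Jx1 _] [/= xx1 yy1].
  have vN s : (s <= x1)%O -> ~ JS s -> (s <= x)%O /\ v \notin limg (f (s, y) (x, y)).
    move=> sx1 /not_andP[]/not_implyP[h1].
      by move/contrapT => e; case: (Jx1.1 xx1); apply: vmono e.
    by move/negP.
  have [exN|nexN] := pselect (exists s, (s <= x1)%O /\ ~ JS s).
    exact: band_functional xx1 yy1 (K0 _ Jx1 xx1) vN exN.
  have fv0 : f (x, y) (x1, y1) v != 0.
    apply/eqP => /(kernel_join xx1 yy1)[v' [e1 e2]].
    have v'0 : v' = 0 by apply/eqP; rewrite -memv0 -(K0 _ Jx1 xx1) memv_ker e1.
    move: e2; rewrite v'0 subr0 => e2; case/negP: v0.
    by rewrite -memv0 -(KL0 s1 y1) // memv_cap vK memv_ker e2 eqxx.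
  have [|rho [r1 _]] := @separating_functional K _ 0%VS (f (x, y) (x1, y1) v).
    by rewrite memv0.
  exists rho; split=> // -[q1 q2] [/= q1s q2t] nB; case: nexN; exists q1.
  by split=> // J; apply: nB.
exists (fun p => JS p.1 /\ True), b, r; split=> //.
by right; right; left; exists JS; split=> // p; split=> // -[].
Qed.

(** As the sums are full, the smallest vertical image is not contained in the largest proper
    horizontal one; [v] is taken in the difference. It generates a vertical band that begins with
    the columns of full horizontal image and is unbounded to the right. *)
Lemma image_band_summand (s0 : S) :
  (s0 <= x)%O -> limg (f (s0, y) (x, y)) != fullv ->
  (forall s, (x <= s)%O -> lker (f (x, y) (s, y)) = 0%VS) ->
  (forall s t, (s <= x)%O -> (t <= y)%O ->
    (limg (f (s, y) (x, y)) + limg (f (x, t) (x, y)) = fullv)%VS) ->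
  has_block_summand f (x, y).
Proof.
move=> s0x n0 K0 IH.
have [|s1 [[s1x nz1] max1]] := exists_maximizer
    (P := fun s => (s <= x)%O /\ limg (f (s, y) (x, y)) != fullv)
    (fun s => dimvS (subvf (limg (f (s, y) (x, y))))).
  by exists s0.
have [|t1 [t1y min1]] := @exists_minimizer T
    (fun t => (t <= y)%O) (fun t => \dim (limg (f (x, t) (x, y)))).
  by exists y.
have [v [vH vI]] : exists v, v \in limg (f (x, t1) (x, y)) /\
    v \notin limg (f (s1, y) (x, y)).
  apply: contrapT => /forallNP h; case/negP: nz1; rewrite -(IH s1 t1) //.
  apply/eqP/esym/addv_idPl/subvP => v vH; apply: contrapT => /negP vI.
  by apply: (h v).
have vHt t : (t <= y)%O -> v \in limg (f (x, t) (x, y)).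
  move=> ty; have [le|/ltW le] := leP t1 t.
    by apply: (subvP (limg_mono fM _ _) _ vH).
  suff /eqP -> : limg (f (x, t) (x, y)) == limg (f (x, t1) (x, y)) by [].
  by rewrite eqEdim min1 // andbT; apply: limg_mono.
pose JS s := (s <= x)%O -> limg (f (s, y) (x, y)) = fullv.
have vN s : ~ JS s -> (s <= x)%O /\ v \notin limg (f (s, y) (x, y)).
  move=> /not_implyP[sx /eqP nz]; split=> //; apply: contra vI.
  have [le|/ltW le] := leP s s1.
    by apply: (subvP (limg_mono fM _ _)).
  suff /eqP -> : limg (f (s1, y) (x, y)) == limg (f (s, y) (x, y)) by [].
  by rewrite eqEdim max1 // andbT; apply: limg_mono.
have JSx : JS x.
  move=> _; apply/vspaceP => w; rewrite memvf.
  by rewrite -[w](pmodule_id fM) memv_img ?memvf.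
have Jup s s' : (s <= s')%O -> JS s -> JS s'.
  move=> ss' Js s'x; apply/eqP; rewrite eqEsubv subvf /= -Js ?limg_mono //.
  exact: le_trans s'x.
have [||b [r br]] := rectangle_summand fM (JT := fun _ => True) (v := v) JSx I.
- move=> [s t] [/= Js _] [/= sx ty].
  have [|u e] := image_meet sx ty _ (vHt t ty); first by rewrite Js ?memvf.
  exists u; split=> // -[q1 q2] [/= sq tq] nB; case: nB; split=> //.
  exact: Jup Js.
- move=> [x1 y1] [/= Jx1 _] [/= xx1 yy1].
  apply: band_functional => //; [exact: K0| by move=> s _; apply: vN|].
  exists s1; split; first exact: le_trans xx1.
  by move=> /(_ s1x) e; case/eqP: nz1.
exists (fun p => JS p.1 /\ True), b, r; split=> //.
right; right; left; exists JS; split; last by move=> p; split=> // -[].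
by split; [exists x | move=> a c d ac _ Ja _; apply: Jup Ja].
Qed.

(** With all four chains trivial, any nonzero vector generates a copy of the constant module, a
    vertical band of full width. *)
Lemma constant_block_summand (v : V (x, y)) : v != 0 ->
  (forall s, (x <= s)%O -> lker (f (x, y) (s, y)) = 0%VS) ->
  (forall t, (y <= t)%O -> lker (f (x, y) (x, t)) = 0%VS) ->
  (forall s, (s <= x)%O -> limg (f (s, y) (x, y)) = fullv) ->
  (forall t, (t <= y)%O -> limg (f (x, t) (x, y)) = fullv) ->
  has_block_summand f (x, y).
Proof.
move=> v0 K0 L0 I1 H1.
have [||b [r br]] := rectangle_summand fM (JS := fun _ => True)
    (JT := fun _ => True) (v := v) I I.
- move=> [s t] _ [/= sx ty]; have [||u e] := @image_meet s t v sx ty.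
  + by rewrite I1 ?memvf.
  + by rewrite H1 ?memvf.
  by exists u; split=> // q _ [].
- move=> [s t] _ [/= xs yt].
  have fv0 : f (x, y) (s, t) v != 0.
    apply/eqP => /(kernel_join xs yt)[v' [e1 e2]].
    have v'0 : v' = 0 by apply/eqP; rewrite -memv0 -(K0 s) // memv_ker e1.
    move: e2; rewrite v'0 subr0 => e2; case/negP: v0.
    by rewrite -memv0 -(L0 t) // memv_ker e2.
  have [|rho [r1 _]] := @separating_functional K _ 0%VS (f (x, y) (s, t) v).
    by rewrite memv0.
  by exists rho; split=> // q _ [].
exists (fun p => True /\ True), b, r; split=> //.
right; right; left; exists (fun _ => True); split; last by [].
by split=> //; exists x.
Qed.

End PointCases.

(* Four chains of subspaces of M_p decide the block: the kernels of the maps to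
   the right and upwards, and the images of the maps from the left and from
   below. *)
Lemma nonzero_has_block_summand (K : fieldType) (dS dT : Order.disp_t)
    (S : orderType dS) (T : orderType dT) (V : S * T -> vectType K)
    (f : forall p q : S * T, 'Hom(V p, V q)) (p : S * T) (v : V p) :
  is_pmodule f -> middle_exact f -> v != 0 -> has_block_summand f p.
Proof.
case: p v => x y v fM fE v0; apply: contrapT => nS.
(* Horizontal bands are vertical bands of the swapped module. Each case excluded below feeds the
   hypotheses of later ones. *)
have fM' := swap_pmodule fM; have fE' := swap_middle_exact fE.
have nS' : ~ has_block_summand (swapf f) (y, x).
  by move/swap_has_block_summand.
have KL s t : (x <= s)%O -> (y <= t)%O ->
    (lker (f (x, y) (s, y)) :&: lker (f (x, y) (x, t)) = 0)%VS.
  move=> xs yt; apply/eqP; apply: contrapT => /negP h.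
  exact: nS (death_block_summand fM fE xs yt h).
have IH s t : (s <= x)%O -> (t <= y)%O ->
    (limg (f (s, y) (x, y)) + limg (f (x, t) (x, y)) = fullv)%VS.
  move=> sx ty; apply/eqP; apply: contrapT => /negP h.
  exact: nS (birth_block_summand fM fE sx ty h).
have K0 s : (x <= s)%O -> lker (f (x, y) (s, y)) = 0%VS.
  move=> xs; apply/eqP; apply: contrapT => /negP h.
  exact: nS (kernel_band_summand fM fE xs h KL).
have L0 t : (y <= t)%O -> lker (f (x, y) (x, t)) = 0%VS.
  move=> yt; apply/eqP; apply: contrapT => /negP h; apply: nS'.
  apply: (kernel_band_summand fM' fE' yt h) => t' s' yt' xs'.
  by rewrite capvC; apply: KL.
have I1 s : (s <= x)%O -> limg (f (s, y) (x, y)) = fullv.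
  move=> sx; apply/eqP; apply: contrapT => /negP h.
  exact: nS (image_band_summand fM fE sx h K0 IH).
have H1 t : (t <= y)%O -> limg (f (x, t) (x, y)) = fullv.
  move=> ty; apply/eqP; apply: contrapT => /negP h; apply: nS'.
  apply: (image_band_summand fM' fE' ty h L0) => t' s' t'y s'x.
  by rewrite addvC; apply: IH.
exact: nS (constant_block_summand fM fE v0 K0 L0 I1 H1).
Qed.

(** * Global decomposition by commuting idempotents *)

Section Decomposition.
Variables (K : fieldType) (dS dT : Order.disp_t)
          (S : orderType dS) (T : orderType dT).
Variables (V : S * T -> vectType K) (f : forall p q : S * T, 'Hom(V p, V q)).

Let endo := forall p, 'End(V p).

Definition natural_idempotent (e : endo) : Prop :=
  (forall p q, ple p q -> forall v, f p q (e p v) = e q (f p q v)) /\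
  forall p v, e p (e p v) = e p v.

Definition commuting (e e' : endo) : Prop :=
  forall p v, e p (e' p v) = e' p (e p v).

Definition commuting_idempotents (E : set endo) : Prop :=
  (forall e, E e -> natural_idempotent e) /\
  forall e e', E e -> E e' -> commuting e e'.

Lemma maximal_commuting_idempotents :
  exists E, commuting_idempotents E /\
    forall h, natural_idempotent h -> (forall e, E e -> commuting h e) -> E h.
Proof.
have [|E [[E1 E2] Emax]] := @Zorn_bigcup endo commuting_idempotents.
  move=> F Fc Ftot; split=> [e [E FE Ee]|e e' [E FE Ee] [E' FE' Ee']].
    by have [h _] := Fc _ FE; apply: h.
  have [sub|sub] := Ftot _ _ FE FE'.
    by have [_ h] := Fc _ FE'; apply: h => //; apply: sub.
  by have [_ h] := Fc _ FE; apply: h => //; apply: sub.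
exists E; split=> // h hI hC; apply: contrapT => nEh.
apply: (Emax (fun e => E e \/ e = h)).
  split; first by move=> e; left.
  by move=> sub; apply/nEh/sub; right.
split=> [e [/E1//|->//]|e e' [Ee|->] [Ee'|->]] //; first exact: E2.
  by move=> p v; rewrite hC.
exact: hC.
Qed.

Hypothesis fM : is_pmodule f.
Hypothesis fE : middle_exact f.

Variable E : set endo.
Hypothesis E_idem : forall e, E e -> natural_idempotent e.
Hypothesis E_comm : forall e e', E e -> E e' -> commuting e e'.
Hypothesis E_max : forall h, natural_idempotent h ->
  (forall e, E e -> commuting h e) -> E h.

(** Maximality puts the identity, products and complements into [E], which is thus a Boolean algebra
    of idempotents. *)
Let idE : endo := fun p => \1%VF.
Let mulE (e e' : endo) : endo := fun p => (e p \o e' p)%VF.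
Let complE (e : endo) : endo := fun p => \1%VF - e p.

Let mulEE e e' p v : mulE e e' p v = e p (e' p v).
Proof. exact: comp_lfunE. Qed.
Let complEE e p v : complE e p v = v - e p v.
Proof. by rewrite lfunE /= opp_lfunE id_lfunE. Qed.

Let E_id : E idE.
Proof.
apply: E_max => [|e Ee p v]; last by rewrite !id_lfunE.
by split=> *; rewrite !id_lfunE.
Qed.

Let E_mul e e' : E e -> E e' -> E (mulE e e').
Proof.
move=> Ee Ee'; have [n i] := E_idem Ee; have [n' i'] := E_idem Ee'.
apply: E_max => [|h Eh p v]; last first.
  by rewrite !mulEE (E_comm Ee' Eh) (E_comm Ee Eh).
split=> [p q pq v|p v]; rewrite !mulEE; first by rewrite n // n'.
by rewrite [e' p (e p _)](E_comm Ee' Ee) i i'.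
Qed.

Let E_compl e : E e -> E (complE e).
Proof.
move=> Ee; have [n i] := E_idem Ee.
apply: E_max => [|h Eh p v]; last first.
  by rewrite !complEE linearB /= (E_comm Ee Eh).
split=> [p q pq v|p v]; rewrite !complEE linearB /=; first by rewrite n.
by rewrite i subrr subr0.
Qed.

(** A character with values 0 and 1 is encoded by the set [X] on which it is 1. *)
Definition eigen (X : set endo) p (v : V p) : Prop :=
  forall e, E e -> (X e -> e p v = v) /\ (~ X e -> e p v = 0).

(* The characters of the Boolean algebra E that have an eigenvector. *)
Definition character := {X : set endo |
  (X `<=` E)%classic /\ exists p (v : V p), v != 0 /\ eigen X v}.

Let char_inj (X X' : character) : sval X = sval X' -> X = X'.
Proof. by case: X X' => [X ?] [X' ?] /= e; apply: eq_exist. Qed.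

Let charE (X : character) e : sval X e -> E e.
Proof. by case: X => X [sub ?] /=; apply: sub. Qed.

Let char_id (X : character) : sval X idE.
Proof.
case: X => X [sub [p [v [/eqP v0 eg]]]] /=; apply: contrapT => /(eg _ E_id).2.
by rewrite id_lfunE.
Qed.

Let char_mul (X : character) e e' :
  sval X e -> sval X e' -> sval X (mulE e e').
Proof.
case: X => X [sub [p [v [/eqP v0 eg]]]] /= Xe Xe'; apply: contrapT => nX.
apply: v0; rewrite -((eg _ (E_mul (sub _ Xe) (sub _ Xe'))).2 nX) mulEE.
by rewrite (eg _ (sub _ Xe')).1 // (eg _ (sub _ Xe)).1.
Qed.

Let char_compl (X : character) e : E e -> ~ sval X e -> sval X (complE e).
Proof.
case: X => X [sub [p [v [/eqP v0 eg]]]] /= Ee nXe; apply: contrapT => nX.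
apply: v0; rewrite -((eg _ (E_compl Ee)).2 nX) complEE.
by rewrite (eg _ Ee).2 // subr0.
Qed.

(** Take the element of the character with smallest image at [p]. Multiplying by another element
    cannot shrink this image, so all of them fix it; idempotents outside act on it by 0 because
    their complements belong to the character. *)
Let eigenprojection (X : character) p :
  exists eps, sval X eps /\ forall v, eigen (sval X) (eps p v).
Proof.
have [|eps [Xeps min_eps]] := @exists_minimizer endo (sval X)
    (fun e => \dim (limg (e p))); first by exists idE; apply: char_id.
have Eeps := charE Xeps; have [_ ieps] := E_idem Eeps.
exists eps; split=> // v.
have fix1 e : sval X e -> e p (eps p v) = eps p v.
  move=> Xe; have Ee := charE Xe; have [_ ie] := E_idem Ee.
  have /eqP eq : limg (mulE e eps p) == limg (eps p).
    rewrite eqEdim min_eps ?andbT; last exact: char_mul.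
    apply/subvP => _ /memv_imgP[w _ ->]; rewrite mulEE (E_comm Ee Eeps).
    by rewrite memv_img ?memvf.
  have : eps p v \in limg (eps p) by rewrite memv_img ?memvf.
  by rewrite -eq => /memv_imgP[w _ ->]; rewrite mulEE ie.
move=> e Ee; split=> [|nXe]; first exact: fix1.
have := fix1 _ (char_compl Ee nXe); rewrite complEE => /eqP.
by rewrite -subr_eq0 addrAC subrr sub0r oppr_eq0 => /eqP.
Qed.

Let eps (X : character) p : endo := projT1 (cid (eigenprojection X p)).
Let epsX X p : sval X (eps X p).
Proof. by rewrite /eps; case: cid => e []. Qed.
Let epsE X p : E (eps X p).
Proof. exact/charE/epsX. Qed.

Definition eigenproj (X : character) p : 'End(V p) := eps X p p.

Lemma eigenproj_eigen X p v : eigen (sval X) (eigenproj X p v).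
Proof. by rewrite /eigenproj /eps; case: cid => e [? h]; exact: h. Qed.

Lemma eigenproj_id X p (v : V p) : eigen (sval X) v -> eigenproj X p v = v.
Proof. by move=> eg; apply: (eg _ (epsE X p)).1; apply: epsX. Qed.

Lemma eigenproj_idem X p v : eigenproj X p (eigenproj X p v) = eigenproj X p v.
Proof. exact/eigenproj_id/eigenproj_eigen. Qed.

Lemma eigenproj_comm X p e v :
  E e -> eigenproj X p (e p v) = e p (eigenproj X p v).
Proof. by move=> Ee; apply: (E_comm (epsE X p) Ee). Qed.

(** Some [e] lies in just one of the two characters; it acts by 1 on one eigenspace, by 0 on the
    other, and commutes with the projection. *)
Lemma eigenproj_other X X' p (v : V p) :
  X <> X' -> eigen (sval X') v -> eigenproj X p v = 0.
Proof.
move=> XX' eg; have eg1 := @eigenproj_eigen X p v.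
have [e [Ee d]] : exists e, E e /\
    (sval X e /\ ~ sval X' e \/ ~ sval X e /\ sval X' e).
  apply: contrapT => /forallNP h; apply: XX'; apply: char_inj.
  apply/seteqP; split=> e Xe; apply: contrapT => nX; case: (h e);
    by split; [exact: charE Xe | first [by left | by right]].
have cm := @eigenproj_comm X p e v Ee.
case: d => [[Xe nX'e]|[nXe X'e]].
  by rewrite -((eg1 _ Ee).1 Xe) -cm (eg _ Ee).2 // linear0.
by rewrite -[RHS]((eg1 _ Ee).2 nXe) -cm (eg _ Ee).1.
Qed.

(** The idempotent behind the projection depends on the point, but those of [p] and [q] fix the
    eigenvectors at both points; inserting both and using their naturality identifies the sides. *)
Lemma eigenproj_natural X p q (v : V p) :
  ple p q -> f p q (eigenproj X p v) = eigenproj X q (f p q v).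
Proof.
move=> pq; have [n1 _] := E_idem (epsE X p); have [n2 _] := E_idem (epsE X q).
rewrite -[RHS]((eigenproj_eigen X (f p q v) (epsE X p)).1 (epsX X p)).
rewrite -(eigenproj_comm _ _ (epsE X p)) -n1 // /eigenproj -n2 //.
by rewrite ((eigenproj_eigen X v (epsE X q)).1 (epsX X q)).
Qed.

Lemma block_projection_natural B b r p q (v : V p) :
  is_block_summand f B b r -> ple p q ->
  f p q (r p v *: b p) = r q (f p q v) *: b q.
Proof.
move=> [h1 h2 h3 h4 h5] pq; rewrite linearZ /=.
have [Bp|nBp] := pselect (B p); have [Bq|nBq] := pselect (B q).
- by have [-> ->] := h3 _ _ pq Bp Bq.
- by rewrite h4 // (h2 q nBq).1 !scaler0.
- by rewrite h5 // scale0r (h2 p nBp).1 linear0 scaler0.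
- by rewrite (h2 q nBq).1 scaler0 (h2 p nBp).1 linear0 scaler0.
Qed.

Lemma eigencomponent_block (X : character) :
  exists B b r, [/\ is_block B, is_block_summand f B b r,
    forall p, eigen (sval X) (b p),
    forall p v, eigenproj X p v = r p v *: b p
  & forall p v, r p (eigenproj X p v) = r p v].
Proof.
pose W p := limg (eigenproj X p).
have memW p v : (v \in W p) <-> eigenproj X p v = v.
  split=> [/memv_imgP[w _ ->]|<-]; first exact: eigenproj_idem.
  by rewrite memv_img ?memvf.
have projW p v : eigenproj X p v \in W p by apply/memW/eigenproj_idem.
pose VX p : vectType K := subvs_of (W p).
have exfX p q : exists F : 'Hom(VX p, VX q),
    forall u, F u = vsproj (W q) (f p q (vsval u)).
  by apply: linear_lfun => a u v; rewrite !linearP.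
pose fX p q : 'Hom(VX p, VX q) := projT1 (cid (exfX p q)).
have fXE p q (u : VX p) : ple p q -> vsval (fX p q u) = f p q (vsval u).
  move=> pq; rewrite /fX; case: cid => F /= ->; rewrite vsprojK //.
  by apply/memW; rewrite -eigenproj_natural // (memW _ _).1 ?subvsP.
have fXM : is_pmodule fX.
  split=> [p|p q r pq qr]; apply/lfunP => u; apply: subvs_inj.
    by rewrite id_lfunE fXE ?(pmodule_id fM) //; exact: ple_refl.
  by rewrite comp_lfunE !fXE ?(pmodule_comp fM) //; apply: ple_trans qr.
have fXX : middle_exact fX.
  move=> x x' y y' xx' yy' /= u w; split=> [/subr0_eq e|[v [<- <-]]].
    have [|v [e1 e2]] := square_lift fE (u := vsval u) (w := vsval w) xx' yy'.
      by rewrite -!fXE ?e.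
    (* The vector glued in the ambient module is projected back to the eigenspace. *)
    exists (vsproj (W (x, y)) (eigenproj X _ v)).
    split; apply: subvs_inj; rewrite fXE // vsprojK ?projW // eigenproj_natural //.
      by rewrite e1; apply/memW; exact: subvsP.
    by rewrite e2; apply/memW; exact: subvsP.
  by apply/eqP; rewrite subr_eq0; apply/eqP/subvs_inj; rewrite !fXE ?(pmodule_comp fM).
have [p0 [v0 [v00 eg0]]] : exists p (v : V p), v != 0 /\ eigen (sval X) v.
  by case: (X) => ? [].
have [|B [b' [r' [Bb Bp0 [h1 h2 h3 h4 h5]]]]] :=
    @nonzero_has_block_summand _ _ _ _ _ VX fX p0 (vsproj (W p0) v0) fXM fXX.
  apply: contra v00 => /eqP e.
  by rewrite -(@vsprojK _ _ (W p0) v0) ?e ?linear0 //; apply/memW/eigenproj_id.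
have exr p : exists F : 'Hom(V p, K^o),
    forall u, F u = r' p (vsproj (W p) (eigenproj X p u)).
  by apply: linear_lfun => a u v; rewrite !linearP.
pose b p : V p := vsval (b' p).
pose r p : 'Hom(V p, K^o) := projT1 (cid (exr p)).
have rE p u : r p u = r' p (vsproj (W p) (eigenproj X p u)).
  by rewrite /r; case: cid.
have bX p : eigenproj X p (b p) = b p by apply/memW; exact: subvsP.
have fr p q u : ple p q -> r q (f p q u) =
    r' q (fX p q (vsproj (W p) (eigenproj X p u))).
  move=> pq; rewrite rE; congr (r' q _); apply: subvs_inj.
  by rewrite fXE // !vsprojK ?projW // eigenproj_natural.
have br : is_block_summand f B b r.
  split.
  - by move=> p Bp; rewrite rE bX vsvalK h1.
  - by move=> p nBp; have [e1 e2] := h2 p nBp; rewrite /b e1; split=> // u; rewrite rE.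
  - move=> p q pq Bp Bq; have [e1 e2] := h3 _ _ pq Bp Bq.
    by split=> [|u]; [rewrite /b -fXE // e1 | rewrite fr // e2 rE].
  - by move=> p q pq Bp nBq; rewrite /b -fXE // h4.
  - by move=> p q pq nBp Bq u; rewrite fr // h5.
have rb p : r p (b p) *: b p = b p.
  case: br => k1 k2 _ _ _; have [Bp|nBp] := pselect (B p).
    by rewrite k1 // scale1r.
  by rewrite (k2 p nBp).1 scaler0.
have exe p : exists F : 'End(V p), forall u, F u = r p u *: b p.
  by apply: linear_lfun => a u v; rewrite linearP scalerDl scalerA.
pose e : endo := fun p => projT1 (cid (exe p)).
have eE p u : e p u = r p u *: b p by rewrite /e; case: cid.
have egb p : eigen (sval X) (b p) by rewrite -bX; apply: eigenproj_eigen.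
have rproj p v : r p (eigenproj X p v) = r p v by rewrite !rE eigenproj_idem.
have Ee : E e.
  apply: E_max.
    split=> [p q pq v|p v]; rewrite !eE; first exact: block_projection_natural br pq.
    by rewrite linearZ /= -scalerA rb.
  move=> a Ea p v; rewrite !eE linearZ /= -(rproj p (a p v)) eigenproj_comm //.
  have [a1 a0] := eigenproj_eigen X v Ea; have [b1 b0] := egb p a Ea.
  have [Xa|nXa] := pselect (sval X a); first by rewrite a1 ?b1 ?rproj.
  by rewrite a0 ?b0 ?linear0 ?scale0r ?scaler0.
(* [e] fixes [b p0], which is nonzero since [r p0] takes 1 on it; so [e] belongs to the character
   and is the identity on its eigenspace. *)
have Xe : sval X e.
  apply: contrapT => nXe; have := (egb p0 e Ee).2 nXe; rewrite eE rb => b0.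
  have [k1 _ _ _ _] := br; have := k1 p0 Bp0; rewrite b0 linear0 => /esym/eqP.
  by rewrite oner_eq0.
exists B, b, r; split=> // p v.
by rewrite -((eigenproj_eigen X v Ee).1 Xe) eE rproj.
Qed.

(* An idempotent of E whose image at p is not contained in one eigenspace
   splits into two of smaller rank at p. *)
Lemma idempotent_ind p (Q : endo -> Prop) :
  (forall e, E e -> (forall v, e p v = 0) -> Q e) ->
  (forall e (X : character), E e -> (forall v, eigen (sval X) (e p v)) -> Q e) ->
  (forall e a, E e -> E a ->
     Q (mulE a e) -> Q (mulE (complE a) e) -> Q e) ->
  forall e, E e -> Q e.
Proof.
move=> Q0 Q1 QD e; have [n] := ubnP (\dim (limg (e p))).
elim: n e => // n IH e /ltnSE lt Ee.
have [z|/existsNP[v0 /eqP nz]] := pselect (forall v, e p v = 0); first exact: Q0.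
have [h|/existsNP[a /not_implyP[Ea /not_orP[na1 na0]]]] := pselect
    (forall a, E a -> (forall v, a p (e p v) = e p v) \/ (forall v, a p (e p v) = 0)).
  pose X : set endo := fun a => E a /\ forall v, a p (e p v) = e p v.
  have eg v : eigen X (e p v).
    move=> a Ea; split=> [[_ //]|nX]; case: (h a Ea) => [h1|//].
    by case: nX.
  apply: (Q1 e (exist _ X _) Ee eg); split; first by move=> a [].
  by exists p, (e p v0).
have small a' : E a' -> (exists v, a' p (e p v) <> e p v) ->
    (\dim (limg (mulE a' e p)) < n)%N.
  move=> Ea' [v nv]; apply: leq_trans lt; rewrite ltnNge; apply/negP => le.
  have /eqP eq : limg (mulE a' e p) == limg (e p).
    rewrite eqEdim le andbT; apply/subvP => _ /memv_imgP[w _ ->].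
    by rewrite mulEE (E_comm Ea' Ee) memv_img ?memvf.
  have : e p v \in limg (e p) by rewrite memv_img ?memvf.
  rewrite -eq => /memv_imgP[w _ ew]; apply: nv.
  by rewrite ew mulEE (E_idem Ea').2.
apply: (QD e a Ee Ea); apply: IH; try exact: E_mul.
- by apply: small => //; move/existsNP: na1.
- apply: small; first exact: E_compl.
  move/existsNP: na0 => [v nv]; exists v; rewrite complEE => /eqP.
  by rewrite -subr_eq0 addrAC subrr sub0r oppr_eq0 => /eqP.
- by apply: E_mul => //; apply: E_compl.
Qed.

Lemma split_idempotent (e a : endo) p v :
  e p v = mulE a e p v + mulE (complE a) e p v.
Proof. by rewrite !mulEE complEE addrC subrK. Qed.

(** Characters index the summands, with the functionals [r X p] as coordinates. For finite support
    and injectivity, induction on idempotents reduces the identity to those whose image at [p] is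
    zero or lies in one eigenspace. *)
Lemma block_decomposition :
  exists (I : Type) (B : I -> S * T -> Prop) (phi : forall p, V p -> I -> K),
    (forall i, is_block (B i)) /\ iso_to_block_sum f B phi.
Proof.
pose B X := projT1 (cid (eigencomponent_block X)).
pose b X := projT1 (cid (projT2 (cid (eigencomponent_block X)))).
pose r X := projT1 (cid (projT2 (cid (projT2 (cid (eigencomponent_block X)))))).
have brP X : [/\ is_block (B X), is_block_summand f (B X) (b X) (r X),
    forall p, eigen (sval X) (b X p),
    forall p v, eigenproj X p v = r X p v *: b X p
  & forall p v, r X p (eigenproj X p v) = r X p v].
  exact: projT2 (cid (projT2 (cid (projT2 (cid (eigencomponent_block X)))))).
have rN X p u : ~ B X p -> r X p u = 0.
  by move=> nB; have [_ [_ h _ _ _] _ _ _] := brP X; exact: (h p nB).2.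
have r_other X X' p (u : V p) : X <> X' -> eigen (sval X') u -> r X p u = 0.
  move=> XX' eg; have [_ _ _ _ <-] := brP X.
  by rewrite (eigenproj_other XX' eg) linear0.
exists character, B, (fun p u X => r X p u); split; first by move=> X; case: (brP X).
split; first by move=> p a u v X; rewrite linearP.
split.
  move=> p u; split; last first.
    by move=> X nz; apply: contrapT => nB; apply/nz/rN.
  pose Q (e : endo) := forall w, exists s, forall X, r X p (e p w) <> 0 -> In X s.
  suff /(_ idE E_id u) : forall e, E e -> Q e by rewrite id_lfunE.
  apply: (@idempotent_ind p) => [e Ee e0 w|e X Ee eg w|e a Ee Ea Q1 Q2 w].
  - by exists nil => X; rewrite e0 linear0.
  - exists [:: X] => X' nz; left; apply: contrapT => /nesym XX'.
    by apply: nz; apply: r_other XX' (eg w).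
  - have [s1 h1] := Q1 w; have [s2 h2] := Q2 w; exists (s1 ++ s2) => X.
    rewrite (split_idempotent e a) linearD /= => nz; apply/in_app_iff.
    apply: contrapT => /not_orP[n1 n2]; apply: nz.
    have -> : r X p (mulE a e p w) = 0 by apply: contrapT => /h1.
    have -> : r X p (mulE (complE a) e p w) = 0 by apply: contrapT => /h2.
    by rewrite addr0.
split.
  move=> p u v eq; apply/eqP; rewrite -subr_eq0; apply/eqP.
  have : forall X, eigenproj X p (u - v) = 0.
    move=> X; have [_ _ _ -> _] := brP X.
    by rewrite linearB /= eq subrr scale0r.
  pose Q (e : endo) := forall w,
    (forall X, eigenproj X p (e p w) = 0) -> e p w = 0.
  suff /(_ idE E_id (u - v)) : forall e, E e -> Q e by rewrite id_lfunE.
  apply: (@idempotent_ind p) => [e Ee e0 w _|e X Ee eg w|e a Ee Ea Q1 Q2 w] //.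
  - by move/(_ X) => <-; rewrite (eigenproj_id (eg w)).
  - move=> h; rewrite (split_idempotent e a).
    have -> : mulE a e p w = 0.
      by apply: (Q1 w) => X; rewrite mulEE (eigenproj_comm _ _ Ea) h linear0.
    rewrite add0r; apply: (Q2 w) => X.
    by rewrite mulEE (eigenproj_comm _ _ (E_compl Ea)) h linear0.
split.
  move=> p g [[s supp] gB]; elim: s g supp gB => [|X s IH] g supp gB.
    exists 0 => X; rewrite linear0; apply/esym; apply: contrapT.
    by move/supp.
  (* The coordinate at [X] is cleared, then restored by a multiple of [b X p], on which the other
     functionals vanish. *)
  pose g' X' := if pselect (X' = X) then 0 else g X'.
  have [||u hu] := IH g'.
  - move=> X'; rewrite /g'; case: pselect => //= XX' /supp[] // e.
    by case: XX'.
  - by move=> X'; rewrite /g'; case: pselect => //= _; apply: gB.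
  exists (u + g X *: b X p) => X'.
  rewrite linearD linearZ /= hu /g'; have [_ _ egX _ _] := brP X.
  case: pselect => /= [->|XX']; last first.
    by rewrite (r_other _ _ _ _ XX' (egX p)) scaler0 addr0.
  rewrite add0r; have [g0|nz] := pselect (g X = 0); first by rewrite g0 scale0r.
  have [_ [h1 _ _ _ _] _ _ _] := brP X.
  by rewrite h1; [exact: mulr1 | exact: gB].
move=> p q u pq X; have [_ [h1 h2 h3 h4 h5] _ _ _] := brP X.
split=> [[Bp Bq]|nB]; first by rewrite (h3 _ _ pq Bp Bq).2.
have [Bq|nBq] := pselect (B X q); last exact: rN.
by apply: h5 => // Bp; apply: nB.
Qed.

End Decomposition.

Theorem theorem1p3 (K : fieldType) (dS dT : Order.disp_t)
  (S : orderType dS) (T : orderType dT)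
  (V : S * T -> vectType K) (f : forall p q : S * T, 'Hom(V p, V q)) :
  is_pmodule f -> middle_exact f ->
  exists (I : Type) (B : I -> S * T -> Prop) (phi : forall p, V p -> I -> K),
    (forall i, is_block (B i)) /\ iso_to_block_sum f B phi.
Proof.
move=> fM fE; have [E [[E_idem E_comm] E_max]] := maximal_commuting_idempotents f.
exact (block_decomposition fM fE E_idem E_comm E_max).
Qed.
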